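(* Let $(H,\alpha)$ be a Hom-bialgebra and $(M,\cdot,\rho,\mu)$ a (left-left) $(H,\alpha)$-Hom-Long dimodule. Then the map $$R_M:M\otimes M\to M\otimes M,\qquad m\otimes n\mapsto n_{(-1)}\cdot m\otimes n_{(0)}\quad(m,n\in M),$$ is a solution of the Hom-Long equation, i.e. $R_M^{12}\circ R_M^{23}=R_M^{23}\circ R_M^{12}$ on $M\otimes M\otimes M$, where $R_M^{12}=R_M\otimes\mu$ and $R_M^{23}=\mu\otimes R_M$.
   Context: All vector spaces, maps and tensor products are over a fixed field $k$; Sweedler notation $\Delta(c)=c_1\otimes c_2$ is used, and $\rho(m)=m_{(-1)}\otimes m_{(0)}$ for coactions. A Hom-algebra $(A,\mu_A,1_A,\alpha)$: a linear space $A$ with a linear multiplication, $1_A\in A$ and a linear bijection $\alpha:A\to A$ with $\alpha(aa')=\alpha(a)\alpha(a')$, $\alpha(1_A)=1_A$, $\alpha(a)(a'a'')=(aa')\alpha(a'')$, $a1_A=1_Aa=\alpha(a)$. A left $(A,\alpha)$-Hom-module $(M,\cdot,\mu)$: a linear space $M$, linear $\cdot:A\otimes M\to M$, and a linear bijection $\mu:M\to M$ with $\mu(a\cdot m)=\alpha(a)\cdot\mu(m)$, $\alpha(a)\cdot(a'\cdot m)=(aa')\cdot\mu(m)$, $1_A\cdot m=\mu(m)$. A Hom-coalgebra $(C,\Delta,\epsilon,\beta)$: linear $\Delta:C\to C\otimes C$, $\epsilon:C\to k$, and a linear bijection $\beta$ with $\Delta(\beta(c))=\beta(c_1)\otimes\beta(c_2)$,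 $\epsilon\circ\beta=\epsilon$, $\beta(c_1)\otimes c_{21}\otimes c_{22}=c_{11}\otimes c_{12}\otimes\beta(c_2)$, $\epsilon(c_1)c_2=c_1\epsilon(c_2)=\beta(c)$. A left $(C,\beta)$-Hom-comodule $(M,\rho,\mu)$: linear $\rho:M\to C\otimes M$ and a linear bijection $\mu$ with $\rho(\mu(m))=\beta(m_{(-1)})\otimes\mu(m_{(0)})$, $\epsilon(m_{(-1)})m_{(0)}=\mu(m)$, $\beta(m_{(-1)})\otimes m_{(0)(-1)}\otimes m_{(0)(0)}=m_{(-1)1}\otimes m_{(-1)2}\otimes\mu(m_{(0)})$. A Hom-bialgebra $(H,\alpha)$: a Hom-algebra and Hom-coalgebra with the same structure map $\alpha$ such that $\Delta(hh')=\Delta(h)\Delta(h')$, $\Delta(1)=1\otimes1$, $\epsilon(hh')=\epsilon(h)\epsilon(h')$, $\epsilon(1)=1$. A left-left $(H,\alpha)$-Hom-Long dimodule $(M,\cdot,\rho,\mu)$: $(M,\cdot,\mu)$ is a left $(H,\alpha)$-Hom-module and $(M,\rho,\mu)$ is a left $(H,\alpha)$-Hom-comodule with $\rho(h\cdot m)=\alpha(m_{(-1)})\otimes\alpha(h)\cdot m_{(0)}$ for all $h\in H$, $m\in M$. *)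

(* Defs.v *)
From HB Require Import structures.
From mathcomp Require Import all_boot all_algebra ring_quotient.
From mathcomp Require Import boolp.
From mathcomp Require Import freeg.

Set Implicit Arguments.
Unset Strict Implicit.
Unset Printing Implicit Defensive.

Import GRing.Theory.
Local Open Scope ring_scope.
Local Open Scope quotient_scope.

Reserved Notation "U ⊗ V" (at level 40, left associativity).
Reserved Notation "u ⊗ₜ v" (at level 40, left associativity).

(* The tensor product of two vector spaces of arbitrary dimension: the free
   vector space on U * V modulo the subspace generated by the bilinearity
   relations. *)
Section TensorProduct.
Variables (k : fieldType) (U V : lmodType k).

Inductive bilinear_relations : {freeg (U * V) / k} -> Prop :=
| bilinear_relations0 : bilinear_relations 0
| bilinear_relationsP a x y :
    bilinear_relations x -> bilinear_relations y ->
    bilinear_relations (a *: x + y)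
| bilinear_relationsl a u u' v :
    bilinear_relations
      (<< (a *: u + u', v) >> - (a *: << (u, v) >> + << (u', v) >>))
| bilinear_relationsr a u v v' :
    bilinear_relations
      (<< (u, a *: v + v') >> - (a *: << (u, v) >> + << (u, v') >>)).

Definition bilinear_relb : {pred {freeg (U * V) / k}} :=
  [pred x | `[< bilinear_relations x >]].

Lemma bilinear_relb_zmod_closed : zmod_closed bilinear_relb.
Proof.
split=> [|x y]; first exact/asboolP/bilinear_relations0.
move=> /asboolP rx /asboolP ry; apply/asboolP.
by rewrite addrC -scaleN1r; apply: bilinear_relationsP.
Qed.

HB.instance Definition _ :=
  GRing.isZmodClosed.Build _ bilinear_relb bilinear_relb_zmod_closed.

Definition tens : Type := {ideal_quot bilinear_relb}.

HB.instance Definition _ := GRing.Zmodule.on tens.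

Let class (x : {freeg (U * V) / k}) : tens := \pi_{ideal_quot bilinear_relb} x.

Let classD x y : class (x + y) = class x + class y.
Proof. exact: (raddfD (\pi_{ideal_quot bilinear_relb})). Qed.

Let class_eq x y : bilinear_relations (x - y) -> class x = class y.
Proof. by move=> r; apply/eqP; rewrite -Quotient.idealrBE; exact/asboolP. Qed.

Let relZ a x : bilinear_relations x -> bilinear_relations (a *: x).
Proof.
move=> rx; rewrite -[_ *: _]addr0.
by apply: bilinear_relationsP => //; exact: bilinear_relations0.
Qed.

Let rel_repr x : bilinear_relations (repr (class x) - x).
Proof.
apply/asboolP; change (repr (class x) - x \in bilinear_relb).
by rewrite Quotient.idealrBE reprK.
Qed.

Let class_repr (t : tens) : class (repr t) = t.
Proof. exact: reprK. Qed.

Definition tens_scale (a : k) (t : tens) : tens := class (a *: repr t).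

Let scale_class a x : tens_scale a (class x) = class (a *: x).
Proof. by apply: class_eq; rewrite -scalerBr; apply: relZ; apply: rel_repr. Qed.

Lemma tens_scaleA a b t : tens_scale a (tens_scale b t) = tens_scale (a * b) t.
Proof. by rewrite -(class_repr t) !scale_class scalerA. Qed.

Lemma tens_scale1 : left_id 1 tens_scale.
Proof. by move=> t; rewrite -(class_repr t) scale_class scale1r. Qed.

Lemma tens_scaleDr : right_distributive tens_scale +%R.
Proof.
move=> a t t'; rewrite -(class_repr t) -(class_repr t').
by rewrite -classD !scale_class scalerDr classD.
Qed.

Lemma tens_scaleDl t : {morph tens_scale^~ t : a b / a + b}.
Proof.
by move=> a b; rewrite -(class_repr t) !scale_class scalerDl classD.
Qed.

HB.instance Definition _ := GRing.Zmodule_isLmodule.Build k tens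
  tens_scaleA tens_scale1 tens_scaleDr tens_scaleDl.

Let classZ a x : class (a *: x) = a *: class x.
Proof. exact/esym/scale_class. Qed.

Definition tpure (u : U) (v : V) : tens := class << (u, v) >>.

Lemma tpure_bilinear : bilinear_for *:%R *:%R tpure.
Proof.
split=> [v a u u'|u a v v'];
  rewrite /= /tpure -classZ -classD; apply: class_eq.
- exact: bilinear_relationsl.
- exact: bilinear_relationsr.
Qed.

HB.instance Definition _ :=
  bilinear_isBilinear.Build k U V tens *:%R *:%R tpure tpure_bilinear.
HB.instance Definition _ (u : U) :=
  GRing.isLinear.Build k V tens *:%R (tpure u) (tpure_bilinear.2 u).

Lemma tens_ind (P : tens -> Prop) :
    P 0 -> (forall a u v t, P t -> P (a *: tpure u v + t)) ->
  forall t, P t.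
Proof.
move=> P0 Pstep t; rewrite -(class_repr t) -[repr t]freeg_sumE.
elim: (dom _) => [|[u v] s IHs].
  by rewrite big_nil; have ->: class 0 = 0 by exact: (raddf0 (\pi_{ideal_quot bilinear_relb})).
rewrite big_cons classD; set c := coeff _ _.
suff ->: class << c *g (u, v) >> = c *: tpure u v by apply: Pstep.
rewrite /tpure -classZ; congr class.
by apply/eqP/freeg_eqP => x; rewrite coeffZ !coeffU mul1r.
Qed.

Lemma tens_ext (W : lmodType k) (f g : {linear tens -> W}) :
  (forall u v, f (tpure u v) = g (tpure u v)) -> f =1 g.
Proof.
move=> fg; elim/tens_ind => [|a u v t IHt]; first by rewrite !linear0.
by rewrite !linearP fg IHt.
Qed.

Section Lift.
Variables (W : lmodType k) (f : {bilinear U -> V -> W}).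

Let lift : {freeg (U * V) / k} -> W := fglift (fun p => f p.1 p.2).

Let liftB x y : lift (x - y) = lift x - lift y.
Proof. exact: lift_is_additive. Qed.

Let lift0 : lift 0 = 0.
Proof. by rewrite -[0]subr0 liftB subrr. Qed.

Let liftD x y : lift (x + y) = lift x + lift y.
Proof. by rewrite -[y in LHS]opprK liftB -[- y]sub0r liftB lift0 sub0r opprK. Qed.

Let liftZ a x : lift (a *: x) = a *: lift x.
Proof.
rewrite -[x]freeg_sumE; elim: (dom x) => [|p s IHs].
  by rewrite big_nil !(scaler0, lift0).
rewrite big_cons scalerDr !liftD scalerDr IHs; congr (_ + _).
suff ->: a *: << coeff p x *g p >> = << a * coeff p x *g p >>.
  by rewrite /lift !liftU scalerA.
by apply/eqP/freeg_eqP => y; rewrite coeffZ !coeffU mulrA.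
Qed.

Let lift_rel x : bilinear_relations x -> lift x = 0.
Proof.
elim=> {x} [|a x y _ IHx _ IHy|a u u' v|a u v v'].
- exact: lift0.
- by rewrite liftD liftZ IHx IHy scaler0 addr0.
- by rewrite liftB liftD liftZ /lift !liftU /= !scale1r linearPl subrr.
- by rewrite liftB liftD liftZ /lift !liftU /= !scale1r linearPr subrr.
Qed.

Definition tlift (t : tens) : W := lift (repr t).

Let tlift_class x : tlift (class x) = lift x.
Proof. by apply/eqP; rewrite -subr_eq0 -liftB lift_rel. Qed.

Lemma tlift_linear : linear tlift.
Proof.
move=> a s t; rewrite -(class_repr s) -(class_repr t).
rewrite -classZ -classD !tlift_class.
by rewrite liftD liftZ.
Qed.

HB.instance Definition _ :=
  GRing.isLinear.Build k tens W *:%R tlift tlift_linear.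

Lemma tliftE u v : tlift (tpure u v) = f u v.
Proof. by rewrite tlift_class /lift liftU scale1r. Qed.

End Lift.
End TensorProduct.

Arguments tpure {k U V} u v.

Notation "U ⊗ V" := (tens U V).
Notation "u ⊗ₜ v" := (tpure u v).

Section TensorMap.
Variables (k : fieldType) (U U' V V' : lmodType k).
Variables (f : {linear U -> U'}) (g : {linear V -> V'}).

Definition tmap2 (u : U) (v : V) : U' ⊗ V' := f u ⊗ₜ g v.

Lemma tmap2_bilinear : bilinear_for *:%R *:%R tmap2.
Proof.
by split=> [v a u u'|u a v v']; rewrite /tmap2 linearP (linearPl, linearPr).
Qed.

HB.instance Definition _ :=
  bilinear_isBilinear.Build k U V (U' ⊗ V') *:%R *:%R tmap2 tmap2_bilinear.

Definition tmap : U ⊗ V -> U' ⊗ V' := tlift tmap2.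

HB.instance Definition _ := GRing.Linear.on tmap.

Lemma tmapE u v : tmap (u ⊗ₜ v) = f u ⊗ₜ g v.
Proof. exact: tliftE. Qed.

End TensorMap.

Section Associator.
Variables (k : fieldType) (U V W : lmodType k).

Definition tassoc2 (t : U ⊗ V) (w : W) : U ⊗ (V ⊗ W) :=
  tmap idfun (applyr tpure w) t.

Lemma tassoc2_bilinear : bilinear_for *:%R *:%R tassoc2.
Proof.
split=> [w a t t'|t a w w']; first by rewrite /tassoc2 linearP.
elim/tens_ind: t => [|b u v t IHt]; first by rewrite /tassoc2 !linear0 /= scaler0 addr0.
rewrite /tassoc2 /= in IHt *; rewrite ![tmap _ _ (_ + _)]linearP /= IHt !tmapE /= /applyr !linearPr.
by rewrite !scalerDr !scalerA [b * a]mulrC !addrA; congr (_ + _); rewrite addrAC.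
Qed.

HB.instance Definition _ :=
  bilinear_isBilinear.Build k (U ⊗ V) W (U ⊗ (V ⊗ W)) *:%R *:%R
    tassoc2 tassoc2_bilinear.

Definition tassoc : (U ⊗ V) ⊗ W -> U ⊗ (V ⊗ W) := tlift tassoc2.

HB.instance Definition _ := GRing.Linear.on tassoc.

Lemma tassocE u v w : tassoc ((u ⊗ₜ v) ⊗ₜ w) = u ⊗ₜ (v ⊗ₜ w).
Proof. by rewrite /tassoc tliftE /= /tassoc2 tmapE. Qed.

Definition tassocV2 (u : U) (t : V ⊗ W) : (U ⊗ V) ⊗ W :=
  tmap (tpure u) idfun t.

Lemma tassocV2_bilinear : bilinear_for *:%R *:%R tassocV2.
Proof.
split=> [t a u u'|u a t t']; last by rewrite /tassocV2 linearP.
elim/tens_ind: t => [|b v w t IHt]; first by rewrite /tassocV2 !linear0 /= scaler0 addr0.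
rewrite /tassocV2 /= in IHt *; rewrite ![tmap _ _ (_ + _)]linearP /= IHt !tmapE /= !linearPl.
by rewrite !scalerDr !scalerA [b * a]mulrC !addrA; congr (_ + _); rewrite addrAC.
Qed.

HB.instance Definition _ :=
  bilinear_isBilinear.Build k U (V ⊗ W) ((U ⊗ V) ⊗ W) *:%R *:%R
    tassocV2 tassocV2_bilinear.

Definition tassocV : U ⊗ (V ⊗ W) -> (U ⊗ V) ⊗ W := tlift tassocV2.

HB.instance Definition _ := GRing.Linear.on tassocV.

Lemma tassocVE u v w : tassocV (u ⊗ₜ (v ⊗ₜ w)) = (u ⊗ₜ v) ⊗ₜ w.
Proof. by rewrite /tassocV tliftE /= /tassocV2 tmapE. Qed.

End Associator.

Arguments tassoc {k U V W}.
Arguments tassocV {k U V W}.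

Lemma tassocK (k : fieldType) (U V W : lmodType k) :
  cancel (@tassoc k U V W) tassocV.
Proof.
elim/tens_ind => [|a t w s IHs]; rewrite ?linear0 // !linearP /= IHs.
congr (_ *: _ + _); elim/tens_ind: t => [|b u v t IHt].
  by rewrite linear0l !linear0.
by rewrite linearPl !linearP /= IHt tassocE tassocVE.
Qed.

Lemma tassocVK (k : fieldType) (U V W : lmodType k) :
  cancel (@tassocV k U V W) tassoc.
Proof.
elim/tens_ind => [|a u t s IHs]; rewrite ?linear0 // !linearP /= IHs.
congr (_ *: _ + _); elim/tens_ind: t => [|b v w t IHt]; first by rewrite !linear0.
by rewrite !linearP /= IHt tassocVE tassocE.
Qed.

Section Twist.
Variables (k : fieldType) (U V : lmodType k).

Definition ttwist2 (u : U) (v : V) : V ⊗ U := v ⊗ₜ u.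

Lemma ttwist2_bilinear : bilinear_for *:%R *:%R ttwist2.
Proof. by split=> [v a u u'|u a v v']; rewrite /ttwist2 (linearPl, linearPr). Qed.

HB.instance Definition _ :=
  bilinear_isBilinear.Build k U V (V ⊗ U) *:%R *:%R ttwist2 ttwist2_bilinear.

Definition ttwist : U ⊗ V -> V ⊗ U := tlift ttwist2.

HB.instance Definition _ := GRing.Linear.on ttwist.

Lemma ttwistE u v : ttwist (u ⊗ₜ v) = v ⊗ₜ u.
Proof. exact: tliftE. Qed.

End Twist.

Arguments ttwist {k U V}.

Section Contraction.
Variables (k : fieldType) (U V : lmodType k).

Section Left.
Variable e : {scalar U}.

Definition tcontractl2 (u : U) (v : V) : V := e u *: v.

Lemma tcontractl2_bilinear : bilinear_for *:%R *:%R tcontractl2.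
Proof.
split=> [v a u u'|u a v v']; rewrite /tcontractl2.
  by rewrite linearP /= scalerDl scalerA.
by rewrite /= scalerDr !scalerA mulrC.
Qed.

HB.instance Definition _ :=
  bilinear_isBilinear.Build k U V V *:%R *:%R tcontractl2 tcontractl2_bilinear.

Definition tcontractl : U ⊗ V -> V := tlift tcontractl2.

HB.instance Definition _ := GRing.Linear.on tcontractl.

Lemma tcontractlE u v : tcontractl (u ⊗ₜ v) = e u *: v.
Proof. exact: tliftE. Qed.

End Left.

Section Right.
Variable e : {scalar V}.

Definition tcontractr2 (u : U) (v : V) : U := e v *: u.

Lemma tcontractr2_bilinear : bilinear_for *:%R *:%R tcontractr2.
Proof.
split=> [v a u u'|u a v v']; rewrite /tcontractr2.
  by rewrite /= scalerDr !scalerA mulrC.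
by rewrite linearP /= scalerDl scalerA.
Qed.

HB.instance Definition _ :=
  bilinear_isBilinear.Build k U V U *:%R *:%R tcontractr2 tcontractr2_bilinear.

Definition tcontractr : U ⊗ V -> U := tlift tcontractr2.

HB.instance Definition _ := GRing.Linear.on tcontractr.

Lemma tcontractrE u v : tcontractr (u ⊗ₜ v) = e v *: u.
Proof. exact: tliftE. Qed.

End Right.
End Contraction.

Section HomStructures.
Variable k : fieldType.

Record hom_algebra (A : lmodType k) (mul : {linear A ⊗ A -> A}) (one : A)
    (alpha : {linear A -> A}) : Prop := HomAlgebra {
  hom_algebra_bij : bijective alpha;
  hom_algebra_alphaM : forall a a', alpha (mul (a ⊗ₜ a')) = mul (alpha a ⊗ₜ alpha a');
  hom_algebra_alpha1 : alpha one = one;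
  hom_algebra_assoc : forall a a' a'',
    mul (alpha a ⊗ₜ mul (a' ⊗ₜ a'')) = mul (mul (a ⊗ₜ a') ⊗ₜ alpha a'');
  hom_algebra_mulr1 : forall a, mul (a ⊗ₜ one) = alpha a;
  hom_algebra_mul1r : forall a, mul (one ⊗ₜ a) = alpha a
}.

Record hom_module (A : lmodType k) (mul : {linear A ⊗ A -> A}) (one : A)
    (alpha : {linear A -> A}) (M : lmodType k) (act : {linear A ⊗ M -> M})
    (mu : {linear M -> M}) : Prop := HomModule {
  hom_module_bij : bijective mu;
  hom_module_mu : forall a m, mu (act (a ⊗ₜ m)) = act (alpha a ⊗ₜ mu m);
  hom_module_assoc : forall a a' m,
    act (alpha a ⊗ₜ act (a' ⊗ₜ m)) = act (mul (a ⊗ₜ a') ⊗ₜ mu m);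
  hom_module_unit : forall m, act (one ⊗ₜ m) = mu m
}.

Record hom_coalgebra (C : lmodType k) (Delta : {linear C -> C ⊗ C})
    (eps : {scalar C}) (beta : {linear C -> C}) : Prop := HomCoalgebra {
  hom_coalgebra_bij : bijective beta;
  hom_coalgebra_beta : forall c, Delta (beta c) = tmap beta beta (Delta c);
  hom_coalgebra_eps : forall c, eps (beta c) = eps c;
  hom_coalgebra_coassoc : forall c,
    tmap beta Delta (Delta c) = tassoc (tmap Delta beta (Delta c));
  hom_coalgebra_counitl : forall c, tcontractl eps (Delta c) = beta c;
  hom_coalgebra_counitr : forall c, tcontractr eps (Delta c) = beta c
}.

Record hom_comodule (C : lmodType k) (Delta : {linear C -> C ⊗ C})
    (eps : {scalar C}) (beta : {linear C -> C}) (M : lmodType k)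
    (rho : {linear M -> C ⊗ M}) (mu : {linear M -> M}) : Prop := HomComodule {
  hom_comodule_bij : bijective mu;
  hom_comodule_mu : forall m, rho (mu m) = tmap beta mu (rho m);
  hom_comodule_counit : forall m, tcontractl eps (rho m) = mu m;
  hom_comodule_coassoc : forall m,
    tmap beta rho (rho m) = tassoc (tmap Delta mu (rho m))
}.

(* (a ⊗ₜ b) ⊗ₜ (a' ⊗ₜ b') is sent to aa' ⊗ₜ bb'. *)
Definition tens_mul (A : lmodType k) (mul : {linear A ⊗ A -> A}) :
    (A ⊗ A) ⊗ (A ⊗ A) -> A ⊗ A :=
  tmap mul mul \o tassocV
    \o tmap idfun (tassoc \o tmap ttwist idfun \o tassocV) \o tassoc.

Lemma tens_mulE (A : lmodType k) (mul : {linear A ⊗ A -> A}) a b a' b' :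
  tens_mul mul ((a ⊗ₜ b) ⊗ₜ (a' ⊗ₜ b')) = mul (a ⊗ₜ a') ⊗ₜ mul (b ⊗ₜ b').
Proof.
rewrite /tens_mul /= tassocE tmapE /= tassocVE tmapE /= ttwistE tassocE.
by rewrite tassocVE tmapE.
Qed.

Record hom_bialgebra (H : lmodType k) (mul : {linear H ⊗ H -> H}) (one : H)
    (Delta : {linear H -> H ⊗ H}) (eps : {scalar H}) (alpha : {linear H -> H}) :
    Prop := HomBialgebra {
  hom_bialgebra_algebra : hom_algebra mul one alpha;
  hom_bialgebra_coalgebra : hom_coalgebra Delta eps alpha;
  hom_bialgebra_DeltaM : forall h h',
    Delta (mul (h ⊗ₜ h')) = tens_mul mul (Delta h ⊗ₜ Delta h');
  hom_bialgebra_Delta1 : Delta one = one ⊗ₜ one;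
  hom_bialgebra_epsM : forall h h', eps (mul (h ⊗ₜ h')) = eps h * eps h';
  hom_bialgebra_eps1 : eps one = 1
}.

Record hom_long_dimodule (H : lmodType k) (mul : {linear H ⊗ H -> H}) (one : H)
    (Delta : {linear H -> H ⊗ H}) (eps : {scalar H}) (alpha : {linear H -> H})
    (M : lmodType k) (act : {linear H ⊗ M -> M}) (rho : {linear M -> H ⊗ M})
    (mu : {linear M -> M}) : Prop := HomLongDimodule {
  hom_long_dimodule_module : hom_module mul one alpha act mu;
  hom_long_dimodule_comodule : hom_comodule Delta eps alpha rho mu;
  hom_long_dimodule_compat : forall h m,
    rho (act (h ⊗ₜ m)) = tmap alpha (act \o tpure (alpha h)) (rho m)
}.

Section LongMap.
Variables (H M : lmodType k).
Variables (act : {linear H ⊗ M -> M}) (rho : {linear M -> H ⊗ M}).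

(* act \o applyr tpure m is the map sending h to h · m, so this is
   n_(-1) · m ⊗ₜ n_(0). *)
Definition long_map2 (m n : M) : M ⊗ M :=
  tmap (act \o applyr tpure m) idfun (rho n).

Lemma long_map2_bilinear : bilinear_for *:%R *:%R long_map2.
Proof.
split=> [n a m m'|m a n n']; last by rewrite /long_map2 !linearP.
rewrite /long_map2; elim/tens_ind: (rho n) => [|b h l t IHt].
  by rewrite !linear0 /= scaler0 addr0.
rewrite ![tmap _ _ (_ + _)]linearP /= IHt !tmapE /= /applyr !(linearPr, linearP) linearPl.
by rewrite !scalerDr !scalerA [b * a]mulrC !addrA; congr (_ + _); rewrite addrAC.
Qed.

HB.instance Definition _ :=
  bilinear_isBilinear.Build k M M (M ⊗ M) *:%R *:%R
    long_map2 long_map2_bilinear.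

Definition long_map : M ⊗ M -> M ⊗ M := tlift long_map2.

HB.instance Definition _ := GRing.Linear.on long_map.

Lemma long_mapE m n :
  long_map (m ⊗ₜ n) = tmap (act \o applyr tpure m) idfun (rho n).
Proof. exact: tliftE. Qed.

End LongMap.

(* The triple tensor product M ⊗ M ⊗ M is taken to be (M ⊗ M) ⊗ M. *)
Section HomLongEquation.
Variables (M : lmodType k) (mu : {linear M -> M}) (R : {linear M ⊗ M -> M ⊗ M}).

Definition leg12 : (M ⊗ M) ⊗ M -> (M ⊗ M) ⊗ M := tmap R mu.

Definition leg23 : (M ⊗ M) ⊗ M -> (M ⊗ M) ⊗ M :=
  tassocV \o tmap mu R \o tassoc.

Definition hom_long_equation : Prop := leg12 \o leg23 =1 leg23 \o leg12.

End HomLongEquation.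
End HomStructures.

(* Main.v *)
From HB Require Import structures.
Require Import Defs.
From mathcomp Require Import all_boot all_algebra.
Local Open Scope ring_scope.
Import GRing.Theory.

Set Implicit Arguments.
Unset Strict Implicit.

(* Both composites send [l ⊗ m ⊗ n] to
    [α(m_(-1))·μ(l) ⊗ α(n_(-1))·m_(0) ⊗ μ(n_(0))]: for R^12 ∘ R^23 the Long
    compatibility rewrites [ρ(n_(-1)·m)], and for R^23 ∘ R^12 one uses that the
    action and the coaction commute with the structure maps. *)

(** For fixed [w], the map [t] ↦ [f (t ⊗ₜ w)] is linear on [U ⊗ V], so [tens_ext] can be applied
    once per tensor factor. *)
Lemma tens3_ext (k : fieldType) (U V W X : lmodType k)
    (f g : {linear (U ⊗ V) ⊗ W -> X}) :
  (forall u v w, f ((u ⊗ₜ v) ⊗ₜ w) = g ((u ⊗ₜ v) ⊗ₜ w)) -> f =1 g.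
Proof.
move=> fg; apply: tens_ext => t w; move: t.
apply: (tens_ext (f := f \o applyr tpure w) (g := g \o applyr tpure w)) => u v.
exact: fg.
Qed.

Section LegLinear.
Variables (k : fieldType) (M : lmodType k).
Variables (mu : {linear M -> M}) (R : {linear M ⊗ M -> M ⊗ M}).

(** The legs are declared as bare functions; extensionality on tensors needs their composites to be
    linear maps. *)
HB.instance Definition _ := GRing.Linear.on (leg12 mu R).
HB.instance Definition _ := GRing.Linear.on (leg23 mu R).

End LegLinear.

Section HomLong.
Variables (k : fieldType) (H M : lmodType k) (alpha : {linear H -> H}).
Variables (act : {linear H ⊗ M -> M}) (rho : {linear M -> H ⊗ M}).
Variable mu : {linear M -> M}.

(* [(h ⊗ m) ⊗ (g ⊗ n)] is sent to [α(h)·μ(l) ⊗ α(g)·m ⊗ μ(n)]. *)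
Definition long_common (l : M) : (H ⊗ M) ⊗ (H ⊗ M) -> (M ⊗ M) ⊗ M :=
  tmap (tmap (act \o applyr tpure (mu l) \o alpha)
             (act \o ttwist \o tmap idfun alpha) \o tassoc) mu \o tassocV.

HB.instance Definition _ (l : M) := GRing.Linear.on (long_common l).

Lemma long_commonE l h m g n :
  long_common l ((h ⊗ₜ m) ⊗ₜ (g ⊗ₜ n)) =
  (act (alpha h ⊗ₜ mu l) ⊗ₜ act (alpha g ⊗ₜ m)) ⊗ₜ mu n.
Proof.
by rewrite /long_common /= tassocVE tmapE /= tassocE !tmapE /= tmapE ttwistE.
Qed.

Local Notation R := (long_map act rho).

Lemma leg12_leg23E (l m n : M) :
    (forall h m', rho (act (h ⊗ₜ m')) =
       tmap alpha (act \o tpure (alpha h)) (rho m')) ->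
  leg12 mu R (leg23 mu R ((l ⊗ₜ m) ⊗ₜ n)) =
  long_common l (rho m ⊗ₜ rho n).
Proof.
move=> compat; rewrite /leg23 /= tassocE tmapE /= long_mapE.
(* [rho n] need not be a pure tensor, but both sides depend linearly on it, so it may be replaced by
   [g ⊗ₜ n']. *)
apply: (tens_ext
  (f := leg12 mu R \o tassocV \o tpure (mu l)
          \o tmap (act \o applyr tpure m) idfun)
  (g := long_common l \o tpure (rho m))) => g n' /=.
rewrite tmapE /= tassocVE /leg12 tmapE /= long_mapE compat.
(* Compatibility has turned [rho (act (g ⊗ₜ m))] into a linear image of [rho m], which may now be
   replaced by [h ⊗ₜ m']. *)
apply: (tens_ext
  (f := applyr tpure (mu n') \o tmap (act \o applyr tpure (mu l)) idfun
          \o tmap alpha (act \o tpure (alpha g)))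
  (g := long_common l \o applyr tpure (g ⊗ₜ n'))) => h m' /=.
by rewrite /applyr !tmapE /= long_commonE.
Qed.

Lemma leg23_leg12E (l m n : M) :
    (forall h m', mu (act (h ⊗ₜ m')) = act (alpha h ⊗ₜ mu m')) ->
    (forall m', rho (mu m') = tmap alpha mu (rho m')) ->
  leg23 mu R (leg12 mu R ((l ⊗ₜ m) ⊗ₜ n)) =
  long_common l (rho m ⊗ₜ rho n).
Proof.
move=> mu_act rho_mu; rewrite /leg12 tmapE /= long_mapE.
(* Here [leg12] acts first, so [rho m] is expanded before [rho n]. The outer [mu] will then fall on
   [act (h ⊗ₜ l)], and the inner coaction on [mu n]. *)
apply: (tens_ext
  (f := leg23 mu R \o applyr tpure (mu n)
          \o tmap (act \o applyr tpure l) idfun)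
  (g := long_common l \o applyr tpure (rho n))) => h m' /=.
rewrite /applyr tmapE /= /leg23 /= tassocE tmapE /= long_mapE rho_mu mu_act.
apply: (tens_ext
  (f := tassocV \o tpure (act (alpha h ⊗ₜ mu l))
          \o tmap (act \o applyr tpure m') idfun \o tmap alpha mu)
  (g := long_common l \o tpure (h ⊗ₜ m'))) => g n' /=.
by rewrite !tmapE /= tassocVE long_commonE.
Qed.

End HomLong.

Theorem theorem5p10 (k : fieldType) (H : lmodType k)
    (mul : {linear H ⊗ H -> H}) (one : H)
    (Delta : {linear H -> H ⊗ H}) (eps : {scalar H}) (alpha : {linear H -> H})
    (M : lmodType k) (act : {linear H ⊗ M -> M}) (rho : {linear M -> H ⊗ M})
    (mu : {linear M -> M}) :
  hom_bialgebra mul one Delta eps alpha ->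
  hom_long_dimodule mul one Delta eps alpha act rho mu ->
  hom_long_equation mu (long_map act rho).
Proof.
move=> _ [[_ mu_act _ _] [_ rho_mu _ _] compat].
apply: tens3_ext => l m n /=.
by rewrite (leg12_leg23E _ _ _ _ compat) (leg23_leg12E _ _ _ mu_act rho_mu).
Qed.
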